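(* Assume $Z$ is a true $\mathbb Q$-martingale on $[0,T]$, let $q_t=E_{\mathbb Q}[Z_tX_t|\mathcal Y_t]$ and let $v_t$ be the smoother vector (with $v_T=\mathbf 1$ and $E_{\mathbb Q}[Z_TX_t|\mathcal Y_T]=\mathrm{diag}(v_t)q_t$). Define the diagonal matrix-valued process $$\Gamma_t=\exp\Big(-\int_{]0,t]}(\Lambda_s-I)\,ds\Big)\prod_{s\in]0,t]}\Lambda_s^{\Delta Y_s}.$$ Then $\bar q_t:=\Gamma_t^{-1}q_t$ and $\bar v_t:=\Gamma_tv_t$ satisfy, for $0\le t\le T$, $$\bar q_t=\bar q_0+\int_{]0,t]}\Gamma_s^{-1}A_s\Gamma_s\,\bar q_s\,ds,$$ $$\bar v_t=\bar v_0-\int_{]0,t]}\Gamma_sA_s^\top\Gamma_s^{-1}\,\bar v_s\,ds=\Gamma_T\mathbf 1+\int_{]t,T]}\Gamma_sA_s^\top\Gamma_s^{-1}\,\bar v_s\,ds,$$ and $\langle q_t,v_t\rangle=\langle\bar q_t,\bar v_t\rangle$.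
   Context: Let $\mathcal X=\{e_1,\dots,e_N\}$ be the standard basis of $\mathbb R^N$ and $\mathbf 1=(1,\dots,1)^\top$. $X$ is a continuous-time Markov chain with values in $\mathcal X$ and deterministic rate matrix $A_t$ ($[A_t]_{ij}$, $i\ne j$, is the rate of jumping from $e_j$ to $e_i$). $Y$ is a counting process (right-continuous, integer-valued, nondecreasing, $Y_0=0$, jumps of size $1$), $\mathbb D$ its path space, $\mathcal Y_t=\sigma(Y_s;s\le t)$, $\mathcal F_t=\sigma(Y_s,X_s;s\le t)$. The intensity function $\lambda:\mathcal X\times[0,\infty[\times\mathbb D\to]0,\infty[$ is measurable with respect to (all subsets of $\mathcal X$) $\times$ (the predictable $\sigma$-algebra of $\{\mathcal Y_t\}$), with $s\mapsto\lambda(X_{s-},s,Y_{(\cdot)})$ left-continuous; $\lambda_u=\lambda(X_{u-},u,Y_{(\cdot)})$, and $\Lambda_u$ is the diagonal matrix with $(\Lambda_u)_{ii}=\lambda(e_i,u,Y_{(\cdot)})$. $\mathbb Q$ is a measure under which $Y$ is a rate-$1$ Poisson process independent of $X$ and $X$ is Markov with rate matrix $A_t$; $Z_t=\exp(-\int_{]0,t]}(\lambda_u-1)du)\prod_{u\in]0,t]}\lambda_u^{\Delta Y_u}$. The filter satisfies $q_t=q_0+\int_{]0,t]}(\Lambda_u-I)q_{u-}(dY_u-du)+\int_{]0,t]}A_uq_u\,du$ and the smoother vector satisfies $dv_t=-(A_t^\top-\Lambda_t+I)v_{t-}dt+(\Lambda_t^{-1}-I)v_{t-}dY_t$, $v_T=\mathbf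 1$. *)

(* Defs.v *)
From HB Require Import structures.
From mathcomp Require Import all_boot all_order all_algebra.
From mathcomp Require Import all_classical all_reals all_analysis.
Set Implicit Arguments. Unset Strict Implicit. Unset Printing Implicit Defensive.
Import Order.TTheory GRing.Theory Num.Theory.
Import numFieldNormedType.Exports.
Local Open Scope classical_set_scope.
Local Open Scope ring_scope.

Section PilotDefs.
Context {R : realType}.

Definition mxintegrable (m n : nat) (D : set R) (F : R -> 'M[R]_(m, n)) : Prop :=
  forall i j, (@lebesgue_measure R).-integrable D (fun s => (F s i j)%:E).

Definition mxint (m n : nat) (D : set R) (F : R -> 'M[R]_(m, n)) : 'M[R]_(m, n) :=
  \matrix_(i, j) (\int[@lebesgue_measure R]_(s in D) F s i j).

Definition lim_left (f : R -> R) (t : R) : R := lim (f x @[x --> t^'-]).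

Definition has_left_limits (m n : nat) (F : R -> 'M[R]_(m, n)) (D : set R) : Prop :=
  forall t, D t -> forall i j, exists l : R, F x i j @[x --> t^'-] --> l.

Definition mx_left (m n : nat) (F : R -> 'M[R]_(m, n)) (t : R) : 'M[R]_(m, n) :=
  \matrix_(i, j) lim_left (fun s => F s i j) t.

(* Stieltjes integral  \int_{]a,b]} F(s) dY_s  for the counting path Y whose
   jump times are the (distinct) elements of ts (all jumps of size 1) *)
Definition jump_int (m n : nat) (ts : seq R) (a b : R) (F : R -> 'M[R]_(m, n))
  : 'M[R]_(m, n) := \sum_(s <- ts | (a < s <= b)) F s.

(* Lambda_s = diag(lambda(e_i, s, Y)) *)
Definition Lam (N : nat) (lam : 'I_N -> R -> R) (s : R) : 'M[R]_N :=
  diag_mx (\row_i lam i s).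

Definition Gamma (N : nat) (ts : seq R) (lam : 'I_N -> R -> R) (t : R) : 'M[R]_N :=
  diag_mx (\row_i (expR (- (\int[@lebesgue_measure R]_(s in `]0, t]) (lam i s - 1)))
                   * \prod_(s <- ts | (0 < s <= t)) lam i s)).

(* rate matrix: [M]_{ij} (i <> j) is the rate of jumping from e_j to e_i *)
Definition rate_matrix (N : nat) (M : 'M[R]_N) : Prop :=
  (forall i j : 'I_N, i != j -> 0 <= M i j) /\ (forall j : 'I_N, \sum_i M i j = 0).

Definition inner (N : nat) (a b : 'cV[R]_N) : R := \sum_i a i 0 * b i 0.

End PilotDefs.

(* Main.v *)
From Pilot Require Import Defs.
From HB Require Import structures.
From mathcomp Require Import all_boot all_order all_algebra.
From mathcomp Require Import all_classical all_reals all_analysis.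
From mathcomp Require Import measurable_realfun ring lra.
Import Order.TTheory GRing.Theory Num.Theory.
Import numFieldNormedType.Exports.
Local Open Scope classical_set_scope.
Local Open Scope ring_scope.

(* Coordinate by coordinate, q and v solve scalar equations
     dx = (m - 1) x_- dY - alpha x_- dt + f dt,
   with m = lambda_i, alpha = lambda_i - 1 for q, and m = 1 / lambda_i, alpha = 1 - lambda_i for v.
   Multiplying by G = exp (int alpha) prod 1/m, which is 1/Gamma_i for q and Gamma_i for v,
   removes both the drift and the jumps: G x - int G f is constant between jumps (product rule) and
   left-continuous at the jumps (there x = m x_- and G = G_- / m), hence constant. The coefficients
   are only Lebesgue integrable, so the product rule is obtained from the fundamental theorem of
   calculus for continuous integrands by approximation in L^1. *)

(** * Chain and product rules for indefinite Lebesgue integrals *)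

Section indefinite_integral.
Context {R : realType}.
Notation mu := (@lebesgue_measure R).
Implicit Types (a b c t x : R) (f g : R -> R).

Lemma subset_itv_oc_lr a b x y : a <= x -> y <= b -> `]x, y] `<=` `]a, b].
Proof. by move=> ax yb; apply: subset_itv; rewrite bnd_simp. Qed.

(** Extending [f] by zero off []a, b]] gives a function integrable on the whole line, for which
    continuity of the integral in its upper bound is available. *)
Lemma continuous_indef_integral a b f : a <= b ->
  mu.-integrable `]a, b] (EFin \o f) ->
  {within `[a, b], continuous (fun x => \int[mu]_(s in `]a, x]) f s)}.
Proof.
move=> ab intf; pose g := f \_ `]a, b].
have intg : mu.-integrable setT (EFin \o g).
  by rewrite -restrict_EFin -integrable_mkcond.
have := parameterized_integral_continuous ab (integrableS measurableT _ (subsetT _) intg).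
move=> /(_ (measurable_itv _)); apply: subspace_eq_continuous => x.
rewrite inE /= in_itv /= => /andP[ax xb].
rewrite /parameterized_integral /from_subspace -Rintegral_itv_obnd_cbnd; last exact: integrableS intg.
apply: eq_Rintegral => s; rewrite inE/= => sx.
rewrite /g patchE mem_set//; apply: subset_itv_oc_lr sx => //.
Qed.

Lemma cvg_at_left_indef_integral a b f : a < b ->
  mu.-integrable `]a, b] (EFin \o f) ->
  (\int[mu]_(s in `]a, x]) f s) @[x --> b^'-] --> \int[mu]_(s in `]a, b]) f s.
Proof.
move=> ab intf; have := continuous_indef_integral _ _ _ (ltW ab) intf.
by move=> /(continuous_within_itvP _ ab)[].
Qed.

Lemma measurable_indef_integral a b f : a <= b ->
  mu.-integrable `]a, b] (EFin \o f) ->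
  measurable_fun `]a, b] (fun x => \int[mu]_(s in `]a, x]) f s).
Proof.
move=> ab intf; apply: (@measurable_funS _ _ _ _ `[a, b]) => //.
  exact: subset_itv_oc_cc.
by apply: subspace_continuous_measurable_fun => //; exact: continuous_indef_integral.
Qed.

Lemma le_norm_indef_integral a b f x : a <= x <= b ->
  mu.-integrable `]a, b] (EFin \o f) ->
  `|\int[mu]_(s in `]a, x]) f s| <= \int[mu]_(s in `]a, b]) `|f s|.
Proof.
move=> /andP[ax xb] intf.
have intfx : mu.-integrable `]a, x] (EFin \o f).
  by apply: integrableS intf => //; exact: subset_itv_oc_lr.
apply: (le_trans (le_normr_Rintegral _ _)) => //.
rewrite -subr_ge0 (@Rintegral_itvB _ (fun s => `|f s|) (BRight a) (BRight b)) ?bnd_simp//.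
  by apply: Rintegral_ge0 => s _.
exact: integrable_norm.
Qed.

(** Continuity of [g] makes [G] differentiable with derivative [g] inside the interval, so
    [phi \o G] is a primitive of the continuous function [dphi (G s) * g s], and the second
    fundamental theorem applies. *)
Lemma ftc_chain_continuous a b c (phi dphi g : R -> R) : a < b ->
  (forall x, is_derive x 1 phi (dphi x)) -> continuous dphi -> continuous g ->
  let G := fun x => c + \int[mu]_(s in `]a, x]) g s in
  phi (G b) - phi c = \int[mu]_(s in `]a, b]) (dphi (G s) * g s).
Proof.
move=> ab dphiE cdphi cg G.
have intg u w : mu.-integrable `[u, w] (EFin \o g).
  apply: continuous_compact_integrable; first exact: segment_compact.
  exact: continuous_subspaceT.
have intg' u w : mu.-integrable `]u, w] (EFin \o g).
  by apply: integrableS (intg u w) => //; exact: subset_itv_oc_cc.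
have cphi : continuous phi.
  move=> x; apply: differentiable_continuous; apply/derivable1_diffP.
  by case: (dphiE x).
have cG : {within `[a, b], continuous G}.
  move=> x; apply: cvgD; first exact: cvg_cst.
  exact: (continuous_indef_integral a b g (ltW ab) (intg' _ _) x).
have Ga : G a = c by rewrite /G set_itvoc0 Rintegral_set0 addr0.
have dG x : x \in `]a, b[ -> is_derive x 1 G (g x).
  rewrite in_itv/= => /andP[ax xb].
  have [dF Fg] := @continuous_FTC1 R g (BRight a) x b xb (intg' a b) ax (cg x).
  pose I y := \int[mu]_(s in `]a, y]) g s.
  have dI : is_derive x 1 I (g x) by split; rewrite -?derive1E.
  have -> : G = cst c + I by [].
  by rewrite -[g x]add0r; exact: is_deriveD (is_derive_cst _ _ _) dI.
have cdG : {within `[a, b], continuous (fun s => dphi (G s) * g s)}.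
  move=> x; apply: cvgM; last exact: (continuous_subspaceT cg).
  by apply: continuous_cvg; [exact: cdphi|exact: cG].
have cpG : {within `[a, b], continuous (phi \o G)}.
  by move=> x; apply: continuous_cvg; [exact: cphi|exact: cG].
have dpG x : x \in `]a, b[ -> is_derive x 1 (phi \o G) (dphi (G x) * g x).
  move=> xab; have := dG _ xab => ?; have := dphiE (G x) => ?.
  exact: is_derive1_comp.
have /(continuous_within_itvP _ ab)[_ cl cr] := cpG.
have H := @continuous_FTC2 R (fun s => dphi (G s) * g s) (phi \o G) a b ab cdG.
rewrite Rintegral_itv_obnd_cbnd; last first.
  apply: (@integrableS _ _ _ mu `[a, b]) => //; first exact: subset_itv_oc_cc.
  by apply: continuous_compact_integrable; first exact: segment_compact.
rewrite /Rintegral H//=.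
- by rewrite Ga.
- by split=> // x /dpG[].
- by move=> x /dpG[_ <-]; rewrite derive1E.
Qed.

Lemma cvg_seq_le_bound (u : R^nat) (l : R) : u @ \oo --> l ->
  exists M : R, forall n, `|u n| <= M.
Proof.
(* The bound is only granted for numbers strictly above [M], hence [M + 1]. *)
by move=> /cvgP /cvg_seq_bounded[M [_ HM]]; exists (M + 1) => n; apply: HM; rewrite ?ltrDl.
Qed.

Lemma continuous_bounded_ball (f : R -> R) (M : R) : continuous f ->
  exists K : R, forall x, `|x| <= M -> `|f x| <= K.
Proof.
(* For negative [M] the ball is empty and any [K] will do; otherwise [K] is the maximum of [|f|] on
   the compact interval [[- M, M]]. *)
move=> cf; have [M0|M0] := ltP M 0.
  by exists 0 => x xM; have := le_lt_trans (le_trans (normr_ge0 x) xM) M0; rewrite ltxx.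
have cnf : {within `[- M, M], continuous (fun x => `|f x|)}.
  apply: continuous_subspaceT => x; apply: continuous_cvg; [exact: norm_continuous|exact: cf].
have [|k _ kP] := @EVT_max R _ (- M) M _ cnf; first by rewrite ge0_cp.
by exists `|f k| => x; rewrite ler_norml => xM; apply: kP; rewrite in_itv.
Qed.

Lemma integrable_bounded_mul (D : set R) (h f : R -> R) (K : R) : measurable D ->
  measurable_fun D h -> (forall x, D x -> `|h x| <= K) ->
  mu.-integrable D (EFin \o f) ->
  mu.-integrable D (EFin \o (fun x => h x * f x)).
Proof.
move=> mD mh hK intf; apply: (@eq_integrable _ _ _ mu D mD ((EFin \o h) \* (EFin \o f))%E _) => //.
apply: integrableMr => //; exists K; split; first exact: num_real.
by move=> y Ky x Dx; apply: (le_trans (hK _ Dx)); exact: ltW.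
Qed.

Lemma le_norm_integral_bounded_mul (D : set R) (h f : R -> R) (K : R) : measurable D ->
  measurable_fun D h -> (forall x, D x -> `|h x| <= K) ->
  mu.-integrable D (EFin \o f) ->
  `|\int[mu]_(x in D) (h x * f x)| <= K * \int[mu]_(x in D) `|f x|.
Proof.
move=> mD mh hK intf.
have inthf := integrable_bounded_mul _ _ _ _ mD mh hK intf.
apply: (le_trans (le_normr_Rintegral _ _)) => //.
rewrite -RintegralZl//; last exact: integrable_norm.
apply: le_Rintegral => //; first exact: integrable_norm.
  apply: (@eq_integrable _ _ _ mu D mD (fun x => K%:E * (`|f x|)%:E)%E _) => //.
  by apply: integrableZl => //; exact: integrable_norm.
by move=> x Dx; rewrite normrM ler_wpM2r// hK.
Qed.

(** Dominated convergence with dominating function [K * |f|]. *)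
Lemma cvg_integral_bounded_mul (D : set R) (h : (R -> R)^nat) (h0 f : R -> R) (K : R) :
  measurable D -> (forall n, measurable_fun D (h n)) -> measurable_fun D h0 ->
  (forall n x, D x -> `|h n x| <= K) ->
  (forall x, D x -> h ^~ x @ \oo --> h0 x) ->
  mu.-integrable D (EFin \o f) ->
  (\int[mu]_(x in D) (h n x * f x)) @[n --> \oo] --> \int[mu]_(x in D) (h0 x * f x).
Proof.
move=> mD mh mh0 hK hh0 intf.
have mf : measurable_fun D f by apply/measurable_EFinP; exact: measurable_int intf.
have [] := @dominated_convergence _ _ _ mu D mD (fun n x => (h n x * f x)%:E)
  (fun x => (h0 x * f x)%:E) (fun x => (K * `|f x|)%:E).
- by move=> n; apply: ((measurable_EFinP D (fun x => h n x * f x)).2 _); exact: (measurable_funM (mh n) mf).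
- by apply: ((measurable_EFinP D (fun x => h0 x * f x)).2 _); exact: (measurable_funM mh0 mf).
- apply: aeW => x Dx; apply/cvg_EFin; first exact: nearW.
  by apply: cvgMr_tmp; exact: hh0.
- apply: (@eq_integrable _ _ _ mu D mD (fun x => K%:E * (`|f x|)%:E)%E _) => //.
  by apply: integrableZl => //; exact: integrable_norm.
- by apply: aeW => x n Dx; rewrite lee_fin normrM ler_wpM2r// hK.
move=> int0 _ H; have fin0 := @integrable_fin_num _ _ _ mu D mD _ int0.
by move: H; rewrite -(fineK fin0) => /fine_cvgP[].
Qed.

(** Take continuous [g_ n] tending to [f] in L^1, with primitives [H n]. The error [d n] bounds
    [|H n - F|] uniformly on [[a, b]]. Writing [g_ n = f - (f - g_ n)] splits the integral for [H n]
    into a term that converges by dominated convergence and a remainder of size at most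
    [K * d n]. *)
Theorem ftc_chain a b c (phi dphi f : R -> R) : a <= b ->
  (forall x, is_derive x 1 phi (dphi x)) -> continuous dphi ->
  mu.-integrable `]a, b] (EFin \o f) ->
  let F := fun x => c + \int[mu]_(s in `]a, x]) f s in
  phi (F b) - phi c = \int[mu]_(s in `]a, b]) (dphi (F s) * f s).
Proof.
move=> ab dphiE cdphi intf F.
(* The degenerate interval is treated apart because the continuous case needs [a < b]. *)
move: ab; rewrite le_eqVlt => /predU1P[ab|ab].
  by rewrite /F ab set_itvoc0 !Rintegral_set0 addr0 subrr.
pose D : set R := [set` `]a, b]].
have mD : measurable D by exact: measurable_itv.
have Dfin : (mu D < +oo)%E.
  by rewrite /D lebesgue_measure_itv/=; case: ifP => // _; rewrite -EFinB ltry.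
have [g_ [cg intg fg0]] := @approximation_continuous_integrable R D f mD Dfin intf.
pose d n := \int[mu]_(s in D) `|f s - g_ n s|.
have d0 : d @ \oo --> (0 : R) by move/fine_cvgP : fg0 => [_].
have [M1 HM1] := cvg_seq_le_bound _ _ d0.
pose H n x := c + \int[mu]_(s in `]a, x]) g_ n s.
have DS x : a <= x <= b -> `]a, x] `<=` D.
  by move=> /andP[_ xb]; exact: subset_itv_oc_lr.
have intfg n : mu.-integrable D (EFin \o (fun s => f s - g_ n s)).
  by apply: (@eq_integrable _ _ _ mu D mD ((EFin \o f) \- (EFin \o g_ n))%E _) => //; exact: integrableB.
have HF n x : a <= x <= b -> `|H n x - F x| <= d n.
  move=> axb; rewrite distrC /H /F opprD addrACA subrr add0r -RintegralB//.
  - by apply: (le_trans (le_norm_indef_integral a b _ _ axb _)).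
  - by apply: (@integrableS _ _ _ mu D) => //; exact: DS.
  - by apply: (@integrableS _ _ _ mu D) => //; exact: DS.
(* One bound for [F] and all the [H n] at once, so that a single [K] bounds [dphi] along all of
   them. *)
pose M := `|c| + \int[mu]_(s in D) `|f s| + M1.
have M10 : 0 <= M1 by apply: le_trans (HM1 0%N).
have FM0 x : a <= x <= b -> `|F x| <= `|c| + \int[mu]_(s in D) `|f s|.
  by move=> axb; rewrite (le_trans (ler_normD _ _))// lerD2l le_norm_indef_integral.
have FM x : a <= x <= b -> `|F x| <= M.
  by move=> /FM0 /le_trans; apply; rewrite lerDl.
have HM n x : a <= x <= b -> `|H n x| <= M.
  move=> axb; rewrite -[H n x](subrK (F x)) addrC (le_trans (ler_normD _ _))// lerD ?FM0//.
  by rewrite (le_trans (HF _ _ axb))// (le_trans (ler_norm _)).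
have [K HK] := continuous_bounded_ball _ M cdphi.
have Dab x : D x -> a <= x <= b by rewrite /D /= in_itv/= => /andP[/ltW -> ->].
have mdphi : measurable_fun setT dphi by exact: continuous_measurable_fun.
have mF : measurable_fun D (dphi \o F).
  apply: measurableT_comp => //; apply: measurable_funD => //.
  exact: measurable_indef_integral (ltW ab) _.
have mH n : measurable_fun D (dphi \o H n).
  apply: measurableT_comp => //; apply: measurable_funD => //.
  exact: measurable_indef_integral (ltW ab) _.
have cphi : continuous phi.
  move=> x; apply: differentiable_continuous; apply/derivable1_diffP.
  by case: (dphiE x).
have HcF x : a <= x <= b -> H ^~ x @ \oo --> F x.
  move=> axb; apply/cvgrPdist_le => e e0.
  move/cvgrPdist_le : d0 => /(_ e e0); apply: filterS => n.
  rewrite sub0r normrN => dne; rewrite distrC (le_trans (HF _ _ axb))//.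
  by rewrite (le_trans (ler_norm _)).
have lhs : phi (H n b) - phi c @[n --> \oo] --> phi (F b) - phi c.
  apply: cvgB; last exact: cvg_cst.
  by apply: continuous_cvg; [exact: cphi|apply: HcF; rewrite (ltW ab) lexx].
have rhs1 : \int[mu]_(x in D) (dphi (H n x) * f x) @[n --> \oo] -->
    \int[mu]_(x in D) (dphi (F x) * f x).
  apply: (cvg_integral_bounded_mul D (fun n x => dphi (H n x)) _ _ K) => //.
  - by move=> n x Dx; rewrite HK// HM// Dab.
  - by move=> x Dx; apply: continuous_cvg; [exact: cdphi|exact: HcF (Dab _ Dx)].
have rhs2 : \int[mu]_(x in D) (dphi (H n x) * (f x - g_ n x)) @[n --> \oo] --> (0 : R).
  apply/norm_cvg0P; apply: (@squeeze_cvgr _ _ _ _ (cst 0) (fun n => K * d n)).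
  - near=> n; rewrite normr_ge0/= le_norm_integral_bounded_mul//; first exact: mH.
    by move=> x Dx; rewrite HK// HM// Dab.
  - exact: cvg_cst.
  - by rewrite -(mulr0 K); apply: cvgMl_tmp.
have intdH n (h : R -> R) : mu.-integrable D (EFin \o h) ->
    mu.-integrable D (EFin \o (fun x => dphi (H n x) * h x)).
  move=> inth; apply: (integrable_bounded_mul _ _ _ K) => //; first exact: mH.
  by move=> x Dx; rewrite HK// HM// Dab.
have eqn n : phi (H n b) - phi c =
    \int[mu]_(x in D) (dphi (H n x) * f x) -
    \int[mu]_(x in D) (dphi (H n x) * (f x - g_ n x)).
  rewrite (ftc_chain_continuous a b c phi dphi (g_ n))// -RintegralB//; [|exact: intdH..].
  by apply: eq_Rintegral => x _; rewrite -/(H n x) -mulrBr opprB addrC subrK.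
have rhs : phi (H n b) - phi c @[n --> \oo] --> \int[mu]_(x in D) (dphi (F x) * f x).
  rewrite -[X in _ --> X]subr0; under eq_fun do rewrite eqn.
  exact: cvgB rhs1 rhs2.
exact: (cvg_unique _ lhs rhs).
Unshelve. all: by end_near.
Qed.

End indefinite_integral.

(** * Bounded measurable multipliers, product rule and integrating factor *)

Section product_rule.
Context {R : realType}.
Notation mu := (@lebesgue_measure R).
Implicit Types (a b c t x : R) (f g : R -> R).

(** The multipliers that preserve integrability. The class is stable under sums, products and
    composition with continuous functions, so explicit bounds need not be carried along. *)
Definition bounded_measurable (D : set R) (h : R -> R) :=
  measurable_fun D h /\ exists K : R, forall x, D x -> `|h x| <= K.

Lemma eq_bounded_measurable D (h k : R -> R) : (forall x, D x -> h x = k x) ->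
  bounded_measurable D h -> bounded_measurable D k.
Proof.
move=> hk [mh [K hK]]; split.
  by apply: eq_measurable_fun mh => x; rewrite inE; exact: hk.
by exists K => x Dx; rewrite -hk// hK.
Qed.

Lemma bounded_measurable_cst D c : bounded_measurable D (fun=> c).
Proof. by split; [exact: measurable_cst|exists `|c|]. Qed.

Lemma bounded_measurableD D (h k : R -> R) : bounded_measurable D h ->
  bounded_measurable D k -> bounded_measurable D (fun x => h x + k x).
Proof.
move=> [mh [K hK]] [mk [L kL]]; split; first exact: measurable_funD.
exists (K + L) => x Dx; rewrite (le_trans (ler_normD _ _))// lerD//; [exact: hK|exact: kL].
Qed.

Lemma bounded_measurableM D (h k : R -> R) : bounded_measurable D h ->
  bounded_measurable D k -> bounded_measurable D (fun x => h x * k x).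
Proof.
move=> [mh [K hK]] [mk [L kL]]; split; first exact: measurable_funM.
by exists (K * L) => x Dx; rewrite normrM ler_pM ?hK ?kL.
Qed.

Lemma bounded_measurable_comp D (phi h : R -> R) : continuous phi ->
  bounded_measurable D h -> bounded_measurable D (fun x => phi (h x)).
Proof.
move=> cphi [mh [K hK]]; split.
  by apply: (@measurableT_comp _ _ _ _ _ _ phi) => //; exact: continuous_measurable_fun.
have [L HL] := continuous_bounded_ball phi K cphi.
by exists L => x Dx; apply/HL/hK.
Qed.

Lemma bounded_measurable_indef_integral a b f : a <= b ->
  mu.-integrable `]a, b] (EFin \o f) ->
  bounded_measurable `]a, b] (fun x => \int[mu]_(s in `]a, x]) f s).
Proof.
move=> ab intf; split; first exact: measurable_indef_integral.
exists (\int[mu]_(s in `]a, b]) `|f s|) => x /=; rewrite in_itv/= => /andP[ax xb].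
by apply: le_norm_indef_integral => //; apply/andP; split => //; exact: ltW.
Qed.

Lemma integrable_bounded_measurableM D (h f : R -> R) : measurable D ->
  bounded_measurable D h -> mu.-integrable D (EFin \o f) ->
  mu.-integrable D (EFin \o (fun x => h x * f x)).
Proof. move=> mD [mh [K hK]] intf; exact: (integrable_bounded_mul D h f K mD mh hK intf). Qed.

Lemma integrableDr D f g : measurable D ->
  mu.-integrable D (EFin \o f) -> mu.-integrable D (EFin \o g) ->
  mu.-integrable D (EFin \o (fun x => f x + g x)).
Proof.
move=> mD intf intg.
by apply: (@eq_integrable _ _ _ mu D mD ((EFin \o f) \+ (EFin \o g))%E _) => //; exact: integrableD.
Qed.

Lemma integrableBr D f g : measurable D ->
  mu.-integrable D (EFin \o f) -> mu.-integrable D (EFin \o g) ->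
  mu.-integrable D (EFin \o (fun x => f x - g x)).
Proof.
move=> mD intf intg.
by apply: (@eq_integrable _ _ _ mu D mD ((EFin \o f) \- (EFin \o g))%E _) => //; exact: integrableB.
Qed.

(** Polarization: the chain rule for the square is applied to [F], [G] and [F + G], and
    [2FG = (F + G)^2 - F^2 - G^2]. *)
Lemma indef_integral_mul a b c d f g : a <= b ->
  mu.-integrable `]a, b] (EFin \o f) -> mu.-integrable `]a, b] (EFin \o g) ->
  let F := fun x => c + \int[mu]_(s in `]a, x]) f s in
  let G := fun x => d + \int[mu]_(s in `]a, x]) g s in
  F b * G b - c * d = \int[mu]_(s in `]a, b]) (f s * G s + F s * g s).
Proof.
move=> ab intf intg F G.
have dsqr x : is_derive x 1 (fun y : R => y ^+ 2) (2 * x).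
  by apply: is_derive_eq; rewrite /GRing.scale /= ; ring.
have csqr : continuous (fun x : R => 2 * x).
  by move=> x; apply: cvgM; [exact: cvg_cst|exact: cvg_id].
have mD : measurable (`]a, b] : set R) by [].
have intfg := integrableDr _ _ _ mD intf intg.
have chain := ftc_chain a b _ (fun y : R => y ^+ 2) (fun x => 2 * x) _ ab dsqr csqr.
have := chain (c + d) _ intfg; have := chain c _ intf; have := chain d _ intg.
have bmF : bounded_measurable `]a, b] F.
  by apply: bounded_measurableD; [exact: bounded_measurable_cst|exact: bounded_measurable_indef_integral].
have bmG : bounded_measurable `]a, b] G.
  by apply: bounded_measurableD; [exact: bounded_measurable_cst|exact: bounded_measurable_indef_integral].
have FG x : a <= x <= b -> c + d + \int[mu]_(s in `]a, x]) (f s + g s) = F x + G x.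
  move=> /andP[ax xb]; rewrite RintegralD//.
  - by rewrite addrACA.
  - by apply: integrableS intf => //; exact: subset_itv_oc_lr.
  - by apply: integrableS intg => //; exact: subset_itv_oc_lr.
have inth (h k : R -> R) : bounded_measurable `]a, b] h ->
    mu.-integrable `]a, b] (EFin \o k) ->
    mu.-integrable `]a, b] (EFin \o (fun s => 2 * h s * k s)).
  move=> bh ik; apply: integrable_bounded_measurableM => //.
  by apply: bounded_measurableM => //; exact: bounded_measurable_cst.
have intM (h k : R -> R) : bounded_measurable `]a, b] h ->
    mu.-integrable `]a, b] (EFin \o k) ->
    mu.-integrable `]a, b] (EFin \o (fun s => h s * k s)).
  by move=> bh ik; apply: integrable_bounded_measurableM.
rewrite /= -/(F b) -/(G b) => eqG eqF.
rewrite FG ?ab ?lexx//.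
(* The integrand [2 (F + G) (f + g)] is expanded; its square terms are those given by the chain rule
   for [F] and [G] alone, and the cross terms are twice the claimed integrand. *)
have -> : \int[mu]_(s in `]a, b]) (2 * (c + d + \int[mu]_(s0 in `]a, s]) (f s0 + g s0)) * (f s + g s)) =
    \int[mu]_(s in `]a, b]) (2 * F s * f s) + \int[mu]_(s in `]a, b]) (2 * G s * g s) +
    2 * \int[mu]_(s in `]a, b]) (f s * G s + F s * g s).
  have iFG : mu.-integrable `]a, b] (EFin \o (fun s => f s * G s + F s * g s)).
    apply: integrableDr => //; last exact: intM.
    apply: (@eq_integrable _ _ _ mu _ mD (EFin \o (fun s => G s * f s))).
      by move=> s _; rewrite /= mulrC.
    exact: intM.
  rewrite -RintegralZl// -!RintegralD//; [| | |exact: inth..].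
  - apply: eq_Rintegral => s; rewrite inE/= in_itv/= => /andP[/ltW as_ sb].
    by rewrite FG ?as_ ?sb//; ring.
  - by apply: integrableDr => //; exact: inth.
  - by apply: (integrable_bounded_measurableM _ (fun=> 2)) => //; exact: bounded_measurable_cst.
rewrite -[X in X + _ + _]eqF -[X in _ + X + _]eqG => H; lra.
Qed.

Lemma indef_integral_expR a b c f : a <= b ->
  mu.-integrable `]a, b] (EFin \o f) ->
  let F := fun x => c + \int[mu]_(s in `]a, x]) f s in
  expR (F b) = expR c + \int[mu]_(s in `]a, b]) (expR (F s) * f s).
Proof.
move=> ab intf F; apply/eqP; rewrite addrC -subr_eq; apply/eqP.
by apply: (ftc_chain a b c expR expR f) => // x; exact: continuous_expR.
Qed.

(** Product rule for [E] and [x], since [E] is itself the indefinite integral of [E * alpha]. The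
    constant [c] stands for the integral of [alpha] accumulated before [a], which lets the lemma
    start at any time. *)
Lemma integrating_factor a b c x0 alpha g (x : R -> R) : a <= b ->
  mu.-integrable `]a, b] (EFin \o alpha) -> mu.-integrable `]a, b] (EFin \o g) ->
  (forall t, a <= t <= b -> x t = x0 + \int[mu]_(s in `]a, t]) g s) ->
  let E := fun t => expR (c + \int[mu]_(s in `]a, t]) alpha s) in
  E b * x b - E a * x a = \int[mu]_(s in `]a, b]) (E s * (g s + alpha s * x s)).
Proof.
move=> ab inta intg xE E.
have mD : measurable (`]a, b] : set R) by [].
have bE : bounded_measurable `]a, b] E.
  apply: bounded_measurable_comp; first exact: continuous_expR.
  by apply: bounded_measurableD; [exact: bounded_measurable_cst|exact: bounded_measurable_indef_integral].
have intEa : mu.-integrable `]a, b] (EFin \o (fun s => E s * alpha s)).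
  exact: integrable_bounded_measurableM.
have EE t : a <= t <= b -> E t = E a + \int[mu]_(s in `]a, t]) (E s * alpha s).
  move=> /andP[at_ tb]; rewrite {1 2}/E set_itvoc0 Rintegral_set0 addr0.
  apply: indef_integral_expR => //.
  by apply: integrableS inta => //; exact: subset_itv_oc_lr.
have xa : x a = x0 by rewrite xE ?lexx// set_itvoc0 Rintegral_set0 addr0.
rewrite EE ?ab ?lexx// xE ?ab ?lexx// xa.
rewrite (indef_integral_mul a b (E a) x0 _ g)//; apply: eq_Rintegral => s.
rewrite inE/= in_itv/= => /andP[/ltW as_ sb].
by rewrite -EE ?as_// -xE ?as_//; ring.
Qed.

End product_rule.

(** * Sums and products over jump times *)

(** Makes the number of jumps a decreasing measure: stepping back before a jump time loses at least
    that jump. *)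
Lemma count_lt_witness (T : eqType) (s : seq T) (p q : pred T) (x : T) :
  subpred p q -> x \in s -> q x -> ~~ p x -> (count p s < count q s)%N.
Proof.
move=> pq + qx npx; elim: s => // y s IH; rewrite inE => /predU1P[<-|/IH lt] /=.
  by rewrite qx (negbTE npx) /= add0n add1n ltnS sub_count.
by rewrite -addnS leq_add//; case: (boolP (p y)) => // /pq ->.
Qed.

(** Supplies the last jump time in []0, t]]. *)
Lemma exists_maximum d (T : orderType d) (s : seq T) (p : pred T) : has p s ->
  exists2 m, (m \in s) && p m & forall y, y \in s -> p y -> (y <= m)%O.
Proof.
elim: s => // x s IH; have [/IH[m /andP[ms pm] mmax] _|nps] := boolP (has p s).
- have [px|npx] := boolP (p x); last first.
    exists m; first by rewrite inE ms orbT.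
    by move=> y; rewrite inE => /predU1P[->|]; [rewrite (negbTE npx)|exact: mmax].
  have [xm|mx] := leP x m.
    exists m; first by rewrite inE ms orbT.
    by move=> y; rewrite inE => /predU1P[->//|]; exact: mmax.
  exists x; first by rewrite mem_head.
  move=> y; rewrite inE => /predU1P[->//|ys py].
  by rewrite (le_trans (mmax _ ys py))// ltW.
- rewrite /= (negbTE nps) orbF => px; exists x; first by rewrite mem_head.
  by move=> y; rewrite inE => /predU1P[->//|/(hasPn nps)/negbTE ->].
Qed.

Section jumps.
Context {R : realType}.
Notation mu := (@lebesgue_measure R).
Implicit Types (a b c t x : R) (f g : R -> R).

(** There are finitely many jump times, so none lies strictly between [r] and [t] once [r] is close
    enough to [t] from the left. *)
Lemma near_left_jumps (ts : seq R) t :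
  \forall r \near t^'-, {in ts, forall s, (s <= r) = (s < t)}.
Proof.
elim: ts => [|u ts IH]; first by apply: nearW.
have near_u : \forall r \near t^'-, (u <= r) = (u < t).
  have [ut|tu] := ltP u t; near=> r; first by apply/ltW; near: r; exact: nbhs_left_gt.
  by apply/negbTE; rewrite -ltNge (lt_le_trans _ tu)//; near: r; exact: nbhs_left_lt.
by near=> r => s; rewrite inE => /predU1P[->|]; [near: r|move: s; near: r].
Unshelve. all: by end_near. Qed.

(** The jump sum and the jump product are frozen just to the left of [t]; [op] is left abstract to
    cover both. *)
Lemma near_left_big (op : R -> R -> R) (idx : R) (ts : seq R) (h : R -> R) t :
  \forall r \near t^'-, \big[op/idx]_(s <- ts | 0 < s <= r) h s =
                        \big[op/idx]_(s <- ts | 0 < s < t) h s.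
Proof.
have := near_left_jumps ts t; apply: filterS => r tsr.
by rewrite big_seq_cond [RHS]big_seq_cond; apply: eq_bigl => s;
  case: (boolP (s \in ts)) => //= /tsr ->.
Qed.

(** Isolates the contribution of a jump at [t]; by [uniq ts] it occurs at most once, as for a
    counting path with unit jumps. *)
Lemma big_jumps_le (idx : R) (op : Monoid.com_law idx) (ts : seq R) (h : R -> R) t :
  uniq ts -> 0 < t ->
  \big[op/idx]_(s <- ts | 0 < s <= t) h s =
  op (\big[op/idx]_(s <- ts | 0 < s < t) h s) (if t \in ts then h t else idx).
Proof.
move=> uts t0; rewrite (bigID (fun s => s < t))/=; congr (op _ _).
  by apply: eq_bigl => s; have [st|] := ltP s t; rewrite ?andbF// !andbT (ltW st) andbT.
have eqt s : (0 < s <= t) && ~~ (s < t) = (s == t).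
  by rewrite -leNgt -andbA -eq_le; case: eqP => [->|]; rewrite ?t0 ?andbF.
rewrite (eq_bigl _ _ eqt); case: ifPn => [tts|tts].
  by rewrite big_mkcond (bigD1_seq t)//= eqxx big1 ?Monoid.mulm1// => s /negbTE ->.
by rewrite big_seq_cond big1// => s /andP[sts /eqP st]; rewrite -st sts in tts.
Qed.

Lemma big_jumps_const (op : R -> R -> R) (idx : R) (ts : seq R) (h : R -> R) a b : a <= b ->
  {in ts, forall s, ~~ (a < s <= b)} ->
  \big[op/idx]_(s <- ts | 0 < s <= b) h s = \big[op/idx]_(s <- ts | 0 < s <= a) h s.
Proof.
move=> ab nots; rewrite big_seq_cond [RHS]big_seq_cond; apply: eq_bigl => s.
case: (boolP (s \in ts)) => //= /nots; rewrite negb_and -leNgt => /orP[sa|].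
  by rewrite sa (le_trans sa ab).
move=> sb; rewrite (negbTE sb) andbF; apply/esym/negbTE; apply: contra sb => /andP[_ sa].
exact: le_trans sa ab.
Qed.

Lemma bounded_measurable_if (P : R -> bool) c d (D : set R) :
  measurable_fun setT P -> bounded_measurable D (fun r => if P r then c else d).
Proof.
move=> mP; split; last by exists (`|c| + `|d|) => r _; case: ifP => _; rewrite ?lerDl ?lerDr.
by apply: measurable_funTS; exact: measurable_fun_ifT.
Qed.

Lemma bounded_measurable_sum_if (D : set R) (ts : seq R) (P : R -> R -> bool) (h : R -> R) :
  (forall s, measurable_fun setT (P s)) ->
  bounded_measurable D (fun r => \sum_(s <- ts | P s r) h s).
Proof.
move=> mP; elim: ts => [|u ts IH].
  by apply: eq_bounded_measurable (bounded_measurable_cst D 0) => r _; rewrite big_nil.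
apply: eq_bounded_measurable (bounded_measurableD _ _ _ (bounded_measurable_if _ (h u) 0 D (mP u)) IH).
by move=> r _; rewrite big_cons; case: ifP; rewrite ?add0r.
Qed.

Lemma bounded_measurable_prod_if (D : set R) (ts : seq R) (P : R -> R -> bool) (h : R -> R) :
  (forall s, measurable_fun setT (P s)) ->
  bounded_measurable D (fun r => \prod_(s <- ts | P s r) h s).
Proof.
move=> mP; elim: ts => [|u ts IH].
  by apply: eq_bounded_measurable (bounded_measurable_cst D 1) => r _; rewrite big_nil.
apply: eq_bounded_measurable (bounded_measurableM _ _ _ (bounded_measurable_if _ (h u) 1 D (mP u)) IH).
by move=> r _; rewrite big_cons; case: ifP; rewrite ?mul1r.
Qed.

Lemma measurable_jump_le (s : R) : measurable_fun setT (fun r : R => 0 < s <= r).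
Proof. by case: (0 < s); [exact: measurable_fun_ler|exact: measurable_cst]. Qed.

Lemma measurable_jump_lt (s : R) : measurable_fun setT (fun r : R => 0 < s < r).
Proof. by case: (0 < s); [exact: measurable_fun_ltr|exact: measurable_cst]. Qed.

End jumps.

(** * Scalar linear equations with jumps *)

Section linear_jump_equation.
Context {R : realType}.
Notation mu := (@lebesgue_measure R).
Context (T x0 : R) (ts : seq R) (alpha g jump x : R -> R).
Context (T0 : 0 <= T) (uts : uniq ts) (jump0 : forall s, jump s != 0).
Context (inta : mu.-integrable `]0, T] (EFin \o alpha)).
Context (intg : mu.-integrable `]0, T] (EFin \o g)).
(* The drift [- alpha x_-] is part of [g]: the source term of the linear equation is the [f] below. *)
Context (xE : forall t, 0 <= t <= T ->
  x t = x0 + \sum_(s <- ts | 0 < s <= t) (jump s - 1) * lim_left x s +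
        \int[mu]_(s in `]0, t]) g s).

Let J t := \sum_(s <- ts | 0 < s <= t) (jump s - 1) * lim_left x s.
Let E t := expR (\int[mu]_(s in `]0, t]) alpha s).

(* Inverse of the solution of the homogeneous equation dz = (jump - 1) z_- dY - alpha z_- dt, z 0 = 1. *)
Definition jump_exponential (t : R) :=
  expR (\int[mu]_(s in `]0, t]) alpha s) * \prod_(s <- ts | 0 < s <= t) (jump s)^-1.

Local Notation G := jump_exponential.

Lemma integrable_sub0 (f : R -> R) t : 0 <= t <= T ->
  mu.-integrable `]0, T] (EFin \o f) -> mu.-integrable `]0, t] (EFin \o f).
Proof. by move=> /andP[t0 tT]; apply: integrableS => //; exact: subset_itv_oc_lr. Qed.

Lemma bounded_measurable_solution : bounded_measurable `]0, T] x.
Proof.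
apply: (eq_bounded_measurable _ (fun t => x0 + J t + \int[mu]_(s in `]0, t]) g s)).
  by move=> t; rewrite /= in_itv/= => /andP[/ltW t0 tT]; rewrite xE ?t0.
apply: bounded_measurableD; last exact: bounded_measurable_indef_integral.
apply: bounded_measurableD; first exact: bounded_measurable_cst.
exact: bounded_measurable_sum_if measurable_jump_le.
Qed.

Lemma bounded_measurable_jump_exponential : bounded_measurable `]0, T] G.
Proof.
apply: bounded_measurableM; last exact: bounded_measurable_prod_if measurable_jump_le.
apply: bounded_measurable_comp; first exact: continuous_expR.
exact: bounded_measurable_indef_integral.
Qed.

(** Just before [t] the jump sum no longer changes and the integral is continuous, so the left limit
    is read off the equation. *)
Lemma cvg_left_solution t : 0 < t <= T ->
  x r @[r --> t^'-] --> x0 + \sum_(s <- ts | 0 < s < t) (jump s - 1) * lim_left x s +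
                        \int[mu]_(s in `]0, t]) g s.
Proof.
move=> /andP[t0 tT].
have H : x0 + \sum_(s <- ts | 0 < s < t) (jump s - 1) * lim_left x s +
    \int[mu]_(s in `]0, r]) g s @[r --> t^'-] --> 
    x0 + \sum_(s <- ts | 0 < s < t) (jump s - 1) * lim_left x s +
    \int[mu]_(s in `]0, t]) g s.
  apply: cvgD; first exact: cvg_cst.
  apply: cvg_at_left_indef_integral => //.
  by apply: integrable_sub0 => //; rewrite (ltW t0).
apply: cvg_trans H; apply: near_eq_cvg.
have := near_left_big +%R 0 ts (fun s => (jump s - 1) * lim_left x s) t.
move=> Jr; near=> r.
have r0 : 0 < r by near: r; exact: nbhs_left_gt.
have rt : r < t by near: r; exact: nbhs_left_lt.
rewrite xE ?(ltW r0) ?(le_trans (ltW rt))//; congr (_ + _ + _).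
by apply/esym; near: r.
Unshelve. all: by end_near. Qed.

Lemma left_solutionE t : 0 < t <= T -> lim_left x t =
  x0 + \sum_(s <- ts | 0 < s < t) (jump s - 1) * lim_left x s +
  \int[mu]_(s in `]0, t]) g s.
Proof. by move=> /cvg_left_solution /cvg_lim; apply. Qed.

(** The equation at [t] exceeds its left limit by exactly the jump term [(jump t - 1) x_-], present
    only if [t] is a jump time. *)
Lemma solution_left t : 0 < t <= T ->
  x t = (if t \in ts then jump t else 1) * lim_left x t.
Proof.
move=> /andP[t0 tT]; rewrite xE ?(ltW t0)// big_jumps_le//=.
case: ifP => _; last by rewrite mul1r addr0 left_solutionE ?t0.
have -> : jump t * lim_left x t = lim_left x t + (jump t - 1) * lim_left x t by ring.
rewrite [X in _ = X + _]left_solutionE ?t0//; ring.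
Qed.

Lemma bounded_measurable_left_solution : bounded_measurable `]0, T] (lim_left x).
Proof.
apply: eq_bounded_measurable => [t|].
  by rewrite /= in_itv => tT; exact/esym/left_solutionE.
apply: bounded_measurableD; last exact: bounded_measurable_indef_integral.
apply: bounded_measurableD; first exact: bounded_measurable_cst.
exact: bounded_measurable_sum_if measurable_jump_lt.
Qed.

Let f s := g s + alpha s * lim_left x s.

Lemma integrable_drift_free : mu.-integrable `]0, T] (EFin \o f).
Proof.
apply: integrableDr => //.
apply: (@eq_integrable _ _ _ mu _ _ (EFin \o (fun s => lim_left x s * alpha s))) => //.
  by move=> s _ /=; rewrite mulrC.
by apply: integrable_bounded_measurableM => //; exact: bounded_measurable_left_solution.
Qed.

Let intGf : mu.-integrable `]0, T] (EFin \o (fun s => G s * f s)).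
Proof.
apply: integrable_bounded_measurableM => //.
- exact: bounded_measurable_jump_exponential.
- exact: integrable_drift_free.
Qed.

Let K t := G t * x t - \int[mu]_(s in `]0, t]) (G s * f s).

(** On a stretch without jumps [x] is an indefinite integral and [G] is an exponential times the
    fixed product [p] of past jumps, so [integrating_factor] applies. There [x] equals its left
    limit, which turns its integrand into [f]. *)
Let K_no_jump s t : 0 <= s <= t -> t <= T -> {in ts, forall r, ~~ (s < r <= t)} -> K t = K s.
Proof.
move=> /andP[s0 st] tT nots.
have xs r : s <= r <= t -> x r = x s + \int[mu]_(u in `]s, r]) g u.
  move=> /andP[sr rt]; rewrite !xE ?s0 ?(le_trans s0 sr) ?(le_trans _ tT)//.
  rewrite (@big_jumps_const _ _ _ _ _ s r)//; last first.
    by move=> u uts'; apply: contra (nots u uts') => /andP[-> /le_trans->].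
  rewrite -[RHS]addrA; congr (_ + _).
  rewrite -(@Rintegral_itvB _ g (BRight 0) (BRight r) s) ?bnd_simp//; first by rewrite addrC subrK.
  by apply: integrable_sub0 => //; rewrite (le_trans s0 sr) (le_trans rt tT).
have Gs r : s <= r <= t -> G r = expR (\int[mu]_(u in `]0, s]) alpha u + \int[mu]_(u in `]s, r]) alpha u) *
    \prod_(u <- ts | 0 < u <= s) (jump u)^-1.
  move=> /andP[sr rt]; rewrite /G (@big_jumps_const _ _ _ _ _ s r)//; last first.
    by move=> u uts'; apply: contra (nots u uts') => /andP[-> /le_trans->].
  congr (expR _ * _).
  rewrite -(@Rintegral_itvB _ alpha (BRight 0) (BRight r) s) ?bnd_simp//; first by rewrite addrC subrK.
  by apply: integrable_sub0 => //; rewrite (le_trans s0 sr) (le_trans rt tT).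
have sub : `]s, t] `<=` (`]0, T] : set R) by exact: subset_itv_oc_lr.
have intS h : mu.-integrable `]0, T] (EFin \o h) -> mu.-integrable `]s, t] (EFin \o h).
  by apply: integrableS.
have /= key := integrating_factor s t (\int[mu]_(u in `]0, s]) alpha u) (x s) alpha g x
  st (intS _ inta) (intS _ intg) xs.
set p := \prod_(u <- ts | 0 < u <= s) (jump u)^-1 in Gs.
have p0 : p != 0 by rewrite prodf_seq_neq0; apply/allP => u _; rewrite invr_neq0// implybT.
have {}key : G t * x t - G s * x s = \int[mu]_(u in `]s, t]) (G u * f u).
  rewrite !Gs ?lexx ?st//.
  set e := fun t => expR (\int[mu]_(u in `]0, s]) alpha u + \int[mu]_(u in `]s, t]) alpha u) in Gs key *.
  rewrite [LHS](_ : _ = (e t * x t - e s * x s) * p); last by rewrite /e; ring.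
  rewrite key.
  (* The nonzero constant [p] is moved in and out of the integral to pass from the bare exponential
     [e] to [G]. *)
  transitivity ((\int[mu]_(u in `]s, t]) (G u * f u * p^-1)) * p); last first.
    by rewrite RintegralZr ?mulfVK//; exact: intS.
  congr (_ * p); apply: eq_Rintegral => u.
     rewrite inE/= in_itv/= => /andP[su ut].
    rewrite Gs ?(ltW su)// -/(e u) /f.
    have -> : x u = lim_left x u.
      rewrite [LHS]solution_left ?(le_lt_trans s0 su) ?(le_trans ut)//.
      by case: ifPn => [uts'|_]; [have := nots u uts'; rewrite su ut|rewrite mul1r].
    by rewrite mulrAC mulfK.
rewrite -(@Rintegral_itvB _ (fun s => G s * f s) (BRight 0) (BRight t) s) in key.
- by move: key; rewrite /K; lra.
- by apply: integrable_sub0 => //; rewrite (le_trans s0 st) tT.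
- by rewrite bnd_simp.
- by rewrite bnd_simp.
Qed.

(** If [t] is a jump time, the new factor [(jump t)^-1] of [G] cancels the factor [jump t] gained by
    [x], so [G x] has no jump; the remaining terms are continuous from the left. *)
Let K_left t : 0 < t <= T -> K r @[r --> t^'-] --> K t.
Proof.
move=> /andP[t0 tT]; have tT' : 0 <= t <= T by rewrite ltW.
have -> : K t = E t * \prod_(s <- ts | 0 < s < t) (jump s)^-1 * lim_left x t -
    \int[mu]_(s in `]0, t]) (G s * f s).
  rewrite /K /G (@big_jumps_le _ _ _ _ _ t)//= (solution_left t) ?t0//.
  congr (_ - _); rewrite -/(E t); case: ifP => _; last by rewrite mul1r mulr1.
  by rewrite [E t * _]mulrA [LHS]mulrA mulfVK.
apply: cvgB; last by apply: cvg_at_left_indef_integral => //; exact: integrable_sub0.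
apply: cvgM; last by rewrite left_solutionE ?t0//; apply: cvg_left_solution; rewrite t0.
have H : E r * \prod_(s <- ts | 0 < s < t) (jump s)^-1 @[r --> t^'-] -->
    E t * \prod_(s <- ts | 0 < s < t) (jump s)^-1.
  apply: cvgM; last exact: cvg_cst.
  apply: continuous_cvg; first exact: continuous_expR.
  by apply: cvg_at_left_indef_integral => //; exact: integrable_sub0.
apply: cvg_trans H; apply: near_eq_cvg.
have := near_left_big *%R 1 ts (fun s => (jump s)^-1) t; apply: filterS => r.
by rewrite /G -/(E r) => ->.
Qed.

(** Strong induction on the number of jumps in []0, t]]. With [u] the last of them, [K t = K u], and
    [K u] is the left limit of values [K r], [r < u], which see fewer jumps and hence equal [x0]. *)
Let K_const t : 0 <= t <= T -> K t = x0.
Proof.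
have K0 : K 0 = x0.
  rewrite /K /G set_itvoc0 !Rintegral_set0 expR0 xE ?lexx// set_itvoc0 Rintegral_set0.
  have no0 (s : R) : (0 < s <= 0) = false by have [] := ltP 0 s.
  by rewrite !big_pred0//; ring.
have [n] := ubnP (count (fun s => 0 < s <= t) ts); elim: n t => // n IH t.
rewrite ltnS => cn /andP[t0 tT].
have [hasj|noj] := boolP (has (fun s => 0 < s <= t) ts); last first.
  by rewrite -K0; apply: K_no_jump; rewrite ?lexx//; exact/hasPn.
have [u /andP[uts' /andP[u0 ut]] umax] := exists_maximum _ _ _ _ hasj.
have -> : K t = K u.
  apply: K_no_jump => //; first by rewrite ltW.
  move=> r rts; apply/negP => /andP[ur rt].
  by have := umax _ rts; rewrite (lt_trans u0 ur) rt leNgt ur => /(_ isT).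
have cK := K_left u; rewrite u0 (le_trans ut tT) in cK.
apply: (cvg_unique _ (cK isT)); first exact: Rhausdorff.
have : x0 @[r --> u^'-] --> x0 by exact: cvg_cst.
apply: cvg_trans; apply: near_eq_cvg; near=> r.
have r0 : 0 < r by near: r; exact: nbhs_left_gt.
have ru : r < u by near: r; exact: nbhs_left_lt.
apply/esym/IH; last by rewrite ltW//= (le_trans (ltW ru))// (le_trans ut).
(* The jump [u] is counted up to [t] but not up to [r], so the count drops strictly. *)
apply: leq_trans cn; apply: (@count_lt_witness _ ts _ _ u) => //=.
- by move=> s /= /andP[-> /le_trans sr]; rewrite sr// (le_trans (ltW ru)).
- by rewrite u0.
- by rewrite u0/= -ltNge.
Unshelve. all: by end_near. Qed.

Theorem jump_exponential_solution t : 0 <= t <= T ->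
  G t * x t = x0 + \int[mu]_(s in `]0, t]) (G s * f s).
Proof. by move=> tT; rewrite -(K_const t tT) subrK. Qed.

End linear_jump_equation.

(** * The gauge transform *)

Lemma invmx_diag (F : fieldType) (n : nat) (d : 'rV[F]_n) : (forall i, d 0 i != 0) ->
  invmx (diag_mx d) = diag_mx (\row_i (d 0 i)^-1).
Proof.
move=> d0; have dV : diag_mx d *m diag_mx (\row_i (d 0 i)^-1) = 1%:M.
  apply/matrixP => i j; rewrite mul_diag_mx !mxE.
  by case: eqVneq => [->|]; rewrite ?mulr1n ?mulr0n ?mulr0// divff.
have [du _] := mulmx1_unit dV.
by rewrite -[LHS]mulmx1 -dV mulKmx.
Qed.

(** A finite set is Lebesgue-null. This is what allows [v_-] to be replaced by [v] under the
    integral, as they may differ only at jump times. *)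
Lemma eq_Rintegral_off_seq (R : realType) (D : set R) (ts : seq R) (f g : R -> R) :
  measurable D -> (@lebesgue_measure R).-integrable D (EFin \o f) ->
  (@lebesgue_measure R).-integrable D (EFin \o g) ->
  (forall s, D s -> s \notin ts -> f s = g s) ->
  \int[@lebesgue_measure R]_(s in D) f s = \int[@lebesgue_measure R]_(s in D) g s.
Proof.
move=> mD intf intg fg.
have fts : finite_set [set` ts] by exact: finite_seq.
have ts0 := countable_lebesgue_measure0 (finite_set_countable fts).
have mts : measurable ([set` ts] : set R).
  by apply: countable_measurable; [|exact: finite_set_countable].
rewrite /Rintegral (@negligible_integral _ _ _ (@lebesgue_measure R) D [set` ts])//.
rewrite [in RHS](@negligible_integral _ _ _ (@lebesgue_measure R) D [set` ts])//.
congr fine; apply: eq_integral => s; rewrite inE => -[Ds /negP sts].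
by rewrite fg.
Qed.

Lemma Gamma_neq0 (R : realType) (N : nat) (ts : seq R) (lam : 'I_N -> R -> R) (i : 'I_N) t :
  (forall i s, 0 < lam i s) -> Gamma ts lam t i i != 0.
Proof.
move=> lam0; rewrite !mxE eqxx mulr1n mulf_neq0 ?gt_eqF ?expR_gt0//.
by apply: prodr_gt0.
Qed.

Theorem mainTheorem4 (R : realType) (N : nat) (T : R) (ts : seq R)
  (lam : 'I_N -> R -> R) (A : R -> 'M[R]_N) (q v : R -> 'cV[R]_N) :
  0 <= T ->
  (* jump times of the counting path Y on ]0,T] (jumps of size 1, Y_0 = 0) *)
  uniq ts -> (forall s, s \in ts -> 0 < s <= T) ->
  (* intensity: positive, left-continuous, integrable *)
  (forall i s, 0 < lam i s) ->
  (forall i s, 0 < s <= T -> lam i x @[x --> s^'-] --> lam i s) ->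
  (forall i, (@lebesgue_measure R).-integrable `]0, T] (fun s => (lam i s)%:E)) ->
  (* deterministic rate matrix *)
  (forall t, rate_matrix (A t)) ->
  mxintegrable `]0, T] A ->
  (* filter equation *)
  has_left_limits q `]0, T] ->
  mxintegrable `]0, T] (fun u => (Lam lam u - 1%:M) *m mx_left q u) ->
  mxintegrable `]0, T] (fun u => A u *m q u) ->
  (forall t, 0 <= t <= T ->
     q t = q 0 + jump_int ts 0 t (fun u => (Lam lam u - 1%:M) *m mx_left q u)
               - mxint `]0, t] (fun u => (Lam lam u - 1%:M) *m mx_left q u)
               + mxint `]0, t] (fun u => A u *m q u)) ->
  (* smoother equation *)
  has_left_limits v `]0, T] ->
  v T = const_mx 1 ->
  mxintegrable `]0, T] (fun u => ((A u)^T - Lam lam u + 1%:M) *m mx_left v u) ->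
  (forall t, 0 <= t <= T ->
     v t = v 0 - mxint `]0, t] (fun u => ((A u)^T - Lam lam u + 1%:M) *m mx_left v u)
               + jump_int ts 0 t (fun u => (invmx (Lam lam u) - 1%:M) *m mx_left v u)) ->
  forall t, 0 <= t <= T ->
  let Gam := Gamma ts lam in
  let qbar := fun s => invmx (Gam s) *m q s in
  let vbar := fun s => Gam s *m v s in
  [/\ (mxintegrable `]0, T] (fun s => invmx (Gam s) *m A s *m Gam s *m qbar s) /\
      qbar t = qbar 0 + mxint `]0, t] (fun s => invmx (Gam s) *m A s *m Gam s *m qbar s)),
      mxintegrable `]0, T] (fun s => Gam s *m (A s)^T *m invmx (Gam s) *m vbar s),
      vbar t = vbar 0 - mxint `]0, t] (fun s => Gam s *m (A s)^T *m invmx (Gam s) *m vbar s),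
      vbar t = Gam T *m const_mx 1
               + mxint `]t, T] (fun s => Gam s *m (A s)^T *m invmx (Gam s) *m vbar s) &
      inner (q t) (v t) = inner (qbar t) (vbar t)].

Proof.
move=> T0 uts tsT lam0 _ intlam _ intA _ intLq intAq qE _ vT intv vE t t0T Gam qbar vbar.
pose gam i s := Gam s i i.
have gam0 i s : gam i s != 0 by exact: Gamma_neq0.
have GamE s : Gam s = diag_mx (\row_i gam i s).
  by rewrite /Gam /gam /Gamma; congr diag_mx; apply/rowP => i; rewrite !mxE eqxx.
have GamVE s : invmx (Gam s) = diag_mx (\row_i (gam i s)^-1).
  rewrite GamE invmx_diag; first by congr diag_mx; apply/rowP => i; rewrite !mxE.
  by move=> i; rewrite mxE.
have GamK s (w : 'cV[R]_N) : Gam s *m (invmx (Gam s) *m w) = w.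
  apply/matrixP => i j; rewrite GamVE GamE !mul_diag_mx !mxE.
  by rewrite mulrA divff// mul1r.
have GamVK s (w : 'cV[R]_N) : invmx (Gam s) *m (Gam s *m w) = w.
  apply/matrixP => i j; rewrite GamVE GamE !mul_diag_mx !mxE.
  by rewrite mulrA mulVf// mul1r.
have LamV s : invmx (Lam lam s) = diag_mx (\row_i (lam i s)^-1).
  rewrite /Lam invmx_diag; first by congr diag_mx; apply/rowP => i; rewrite !mxE.
  by move=> i; rewrite mxE gt_eqF.
have qfE s : invmx (Gam s) *m A s *m Gam s *m qbar s = invmx (Gam s) *m (A s *m q s).
  by rewrite /qbar -!mulmxA GamK.
have vfE s : Gam s *m (A s)^T *m invmx (Gam s) *m vbar s = Gam s *m ((A s)^T *m v s).
  by rewrite /vbar -!mulmxA GamVK.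
have intlam1 i : (@lebesgue_measure R).-integrable `]0, T] (EFin \o (fun s => lam i s - 1)).
  apply: integrableDr => //; first exact: intlam.
  have Tfin : (lebesgue_measure [set` `]0%R, T]] < +oo)%E.
    by rewrite lebesgue_measure_itv/=; case: ifP => // _; rewrite -EFinB ltry.
  apply: (@measurable_bounded_integrable _ _ _ (@lebesgue_measure R) (fun=> -1) _ _ Tfin) => //.
  by exists 1; split => // y y1 s _ /=; rewrite normrN normr1 ltW.
have sub0 (f : R -> R) s : 0 <= s <= T ->
    (@lebesgue_measure R).-integrable `]0, T] (EFin \o f) ->
    (@lebesgue_measure R).-integrable `]0, s] (EFin \o f).
  by move=> /andP[s0 sT]; apply: integrableS => //; exact: subset_itv_oc_lr.
(* Row [i] of the filter equation: jump factor [lam i], [alpha = lam i - 1], and total drift [g].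
   Adding [alpha q_-] to [g] leaves exactly row [i] of [A q]. *)
have qfacts i : (@lebesgue_measure R).-integrable `]0, T]
      (EFin \o (fun s => (gam i s)^-1 * (A s *m q s) i 0)) /\
    forall s, 0 <= s <= T -> (gam i s)^-1 * q s i 0 = q 0 i 0 +
      \int[@lebesgue_measure R]_(u in `]0, s]) ((gam i u)^-1 * (A u *m q u) i 0).
  pose g u := (A u *m q u) i 0 - ((Lam lam u - 1%:M) *m mx_left q u) i 0.
  have LqE u : ((Lam lam u - 1%:M) *m mx_left q u) i 0 =
      (lam i u - 1) * lim_left (fun s => q s i 0) u.
    by rewrite mulmxBl mul1mx mul_diag_mx !mxE; ring.
  have gE u : g u + (lam i u - 1) * lim_left (fun s => q s i 0) u = (A u *m q u) i 0.
    by rewrite /g LqE subrK.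
  have lamn s : lam i s != 0 by rewrite gt_eqF.
  have intg : (@lebesgue_measure R).-integrable `]0, T] (EFin \o g).
    exact: integrableBr (intAq i 0) (intLq i 0).
  have qiE s : 0 <= s <= T -> q s i 0 = q 0 i 0 +
      \sum_(r <- ts | 0 < r <= s) (lam i r - 1) * lim_left (fun s => q s i 0) r +
      \int[@lebesgue_measure R]_(u in `]0, s]) g u.
    move=> sT; rewrite {1}qE// !mxE summxE RintegralB//; last 2 first.
    - by apply: sub0 => //; exact: intAq.
    - by apply: sub0 => //; exact: intLq.
    under eq_bigr do rewrite LqE.
    by rewrite -addrA [- _ + _]addrC.
  have GE s : jump_exponential ts (fun s => lam i s - 1) (lam i) s = (gam i s)^-1.
    rewrite /gam !mxE eqxx mulr1n invfM -expRN opprK /jump_exponential; congr (_ * _).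
    by rewrite prodfV.
  have bG : bounded_measurable `]0, T] (fun s => (gam i s)^-1).
    apply: eq_bounded_measurable (bounded_measurable_jump_exponential _ ts _ (lam i) T0 (intlam1 i)).
    by move=> s _; rewrite GE.
  split; first exact: integrable_bounded_measurableM bG (intAq i 0).
  move=> s sT; rewrite -GE (jump_exponential_solution _ _ _ _ _ _ _ T0 uts lamn (intlam1 i) intg qiE)//.
  by congr (_ + _); apply: eq_Rintegral => u _; rewrite GE gE.
pose vl j u := lim_left (fun s => v s j 0) u.
(* Row [i] of the smoother equation: jump factor [(lam i)^-1] and [alpha = 1 - lam i]. Signs are
   written as products by [-1] so that scaling lemmas for integrals apply directly. *)
pose alpha i u := -1 * (lam i u - 1).
pose g i u := -1 * (((A u)^T - Lam lam u + 1%:M) *m mx_left v u) i 0.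
have intZ (f : R -> R) : (@lebesgue_measure R).-integrable `]0, T] (EFin \o f) ->
    (@lebesgue_measure R).-integrable `]0, T] (EFin \o (fun s => -1 * f s)).
  by move=> intf; apply: (integrable_bounded_measurableM _ (fun=> -1)) => //; exact: bounded_measurable_cst.
have lamVn i s : (lam i s)^-1 != 0 by rewrite invr_eq0 gt_eqF.
have intalpha i := intZ _ (intlam1 i).
have intg i := intZ _ (intv i 0).
have viE i s : 0 <= s <= T -> v s i 0 = v 0 i 0 +
    \sum_(r <- ts | 0 < r <= s) ((lam i r)^-1 - 1) * lim_left (fun s => v s i 0) r +
    \int[@lebesgue_measure R]_(u in `]0, s]) g i u.
  move=> sT; rewrite {1}vE// !mxE summxE RintegralZl//; last first.
    by apply: sub0 => //; exact: intv.
  have jE r : ((invmx (Lam lam r) - 1%:M) *m mx_left v r) i 0 =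
      ((lam i r)^-1 - 1) * lim_left (fun s => v s i 0) r.
    by rewrite LamV mulmxBl mul1mx mul_diag_mx !mxE; ring.
  under eq_bigr do rewrite jE.
  by rewrite mulN1r addrAC.
have bv j := bounded_measurable_solution _ _ _ _ (fun s => (lam j s)^-1) _ T0 (intg j) (viE j).
have vleft j s : 0 < s <= T -> s \notin ts -> v s j 0 = vl j s.
  move=> sT sts; rewrite (solution_left _ _ _ _ (fun s => (lam j s)^-1) _ uts (intg j) (viE j))//.
  by rewrite (negbTE sts) mul1r.
have gE i u : g i u + alpha i u * vl i u = -1 * \sum_j A u j i * vl j u.
  have -> : \sum_j A u j i * vl j u = ((A u)^T *m mx_left v u) i 0.
    by rewrite !mxE; apply: eq_bigr => j _; rewrite !mxE.
  by rewrite /g mulmxDl mulmxBl mul1mx mul_diag_mx !mxE /alpha /vl; ring.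
(* Restricted to [[0, T]], since pulling [-1] out of the integral uses integrability of
   [lam i - 1]. *)
have GE i s : 0 <= s <= T -> jump_exponential ts (alpha i) (fun s => (lam i s)^-1) s = gam i s.
  move=> sT; rewrite /gam !mxE eqxx mulr1n /jump_exponential RintegralZl//; last exact: sub0.
  by rewrite mulN1r; congr (_ * _); apply: eq_bigr => r _; rewrite invrK.
have itv01 u s : s <= T -> `]0, s]%classic u -> 0 <= u <= T.
  by move=> sT; rewrite /= in_itv/= => /andP[/ltW -> /le_trans ->].
have bG i : bounded_measurable `]0, T] (gam i).
  apply: eq_bounded_measurable (bounded_measurable_jump_exponential _ ts _ (fun s => (lam i s)^-1) T0 (intalpha i)).
  by move=> s /(itv01 _ _ (lexx T)) sT; rewrite GE.
(* [gam i] and the entries of [v] are bounded and measurable, and the entries of [A] are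
   integrable. *)
have intGAv i : (@lebesgue_measure R).-integrable `]0, T]
    (EFin \o (fun s => gam i s * ((A s)^T *m v s) i 0)).
  apply: integrable_bounded_measurableM => //.
  apply: (@eq_integrable _ _ _ (@lebesgue_measure R) _ _ (fun s => \sum_j (v s j 0 * A s j i)%:E)%E) => //.
    move=> s _; rewrite /= mxE sumEFin; congr (_%:E).
    by apply: eq_bigr => j _; rewrite !mxE mulrC.
  apply: integrable_sum => // j _; exact: integrable_bounded_measurableM (bv j) (intA j i).
have vfacts i s : 0 <= s <= T -> gam i s * v s i 0 = v 0 i 0 -
    \int[@lebesgue_measure R]_(u in `]0, s]) (gam i u * ((A u)^T *m v u) i 0).
  move=> sT; have /andP[s0 sleT] := sT.
  rewrite -GE// (jump_exponential_solution _ _ _ _ _ _ _ T0 uts (lamVn i) (intalpha i) (intg i) (viE i))//.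
  congr (_ + _); rewrite -[RHS]mulN1r -RintegralZl//; last exact: sub0.
  (* The source term obtained contains [A^T v_-], the claim [A^T v]; they agree off the jump
     times. *)
  apply: (@eq_Rintegral_off_seq _ _ ts) => //.
  - apply: sub0 => //; apply: integrable_bounded_measurableM => //.
      exact: (bounded_measurable_jump_exponential _ ts _ (fun s => (lam i s)^-1) T0 (intalpha i)).
    exact: (integrable_drift_free _ _ _ _ _ _ _ T0 (intalpha i) (intg i) (viE i)).
  - by apply: sub0 => //; exact: intZ.
  - move=> u us uts'; rewrite GE ?(itv01 _ _ sleT us)// gE mxE mulrCA; congr (_ * (_ * _)).
    apply: eq_bigr => j _; rewrite !mxE -vleft//.
    by move: us; rewrite /= in_itv/= => /andP[-> /le_trans ->].
have GamwE s (w : 'cV[R]_N) i : (Gam s *m w) i 0 = gam i s * w i 0.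
  by rewrite GamE mul_diag_mx !mxE.
have GamVwE s (w : 'cV[R]_N) i : (invmx (Gam s) *m w) i 0 = (gam i s)^-1 * w i 0.
  by rewrite GamVE mul_diag_mx !mxE.
(* At time 0 the integral and the product are empty, so the transform leaves the initial values
   unchanged. *)
have gam00 i : gam i 0 = 1.
  have := GE i 0; rewrite lexx T0 => /(_ isT) <-.
  rewrite /jump_exponential set_itvoc0 Rintegral_set0 expR0 mul1r big_pred0// => r.
  by have [] := ltP 0 r.
have vbE s : 0 <= s <= T -> vbar s = vbar 0 - mxint `]0, s]
    (fun s => Gam s *m (A s)^T *m invmx (Gam s) *m vbar s).
  move=> sT; apply/matrixP => i j; rewrite ord1.
  rewrite [in LHS]/vbar GamwE vfacts// [RHS]mxE [X in _ = _ + X]mxE [X in _ = _ - X]mxE.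
  rewrite [X in _ = X - _]GamwE gam00 mul1r.
  by congr (_ - _); apply: eq_Rintegral => u _; rewrite vfE GamwE.
have intvb : mxintegrable `]0, T] (fun s => Gam s *m (A s)^T *m invmx (Gam s) *m vbar s).
  move=> i j; rewrite ord1.
  by apply: eq_integrable (intGAv i) => // s _; rewrite /= vfE GamwE.
have /andP[t0 tT] := t0T.
split => //.
- split.
    move=> i j; rewrite ord1; have [intq _] := qfacts i.
    by apply: eq_integrable intq => // s _; rewrite /= qfE GamVwE.
  apply/matrixP => i j; rewrite ord1; have [_ qi] := qfacts i.
  rewrite [in LHS]/qbar GamVwE qi// [RHS]mxE [X in _ = _ + X]mxE.
  rewrite [X in _ = X + _]GamVwE gam00 invr1 mul1r.
  by congr (_ + _); apply: eq_Rintegral => u _; rewrite qfE GamVwE.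
- exact: vbE.
(* The terminal form is the difference of the forward equations at [t] and at [T]: the integrals
   over []0, T]] and []0, t]] differ by the one over []t, T]]. *)
- have -> : Gam T *m const_mx 1 = vbar T by rewrite /vbar vT.
  rewrite (vbE t)// (vbE T) ?lexx ?T0// -[RHS]addrA; congr (_ + _).
  apply/matrixP => i j; rewrite !mxE.
  rewrite -(@Rintegral_itvB _ _ (BRight 0) (BRight T) t) ?bnd_simp//; last exact: intvb.
  by rewrite addrA addNr add0r.
- rewrite /inner; apply: eq_bigr => i _.
  by rewrite GamwE GamVwE mulrACA mulVf// mul1r.
Qed.
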